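(* Let $n\ge 1$ be an integer, let $F_1,\dots,F_n$ be probability distributions on $\mathbb{R}$ such that $(F_1,\dots,F_n)$ is jointly mixable with joint center $K\in\mathbb{R}$, let $X_i\in L^0$ with $X_i\sim F_i$ for $i=1,\dots,n$, and let $\|\cdot\|$ be any law-determined norm on $L^0$. Then $$\|(X_i-\mu_i)_+\|\le\sum_{j=1,\,j\ne i}^n\|(X_j-\mu_j)_-\|\quad\text{and}\quad\|(X_i-\mu_i)_-\|\le\sum_{j=1,\,j\ne i}^n\|(X_j-\mu_j)_+\|$$ for all $i=1,\dots,n$ and all $\mu_1,\dots,\mu_n\in\mathbb{R}$ such that $\mu_1+\dots+\mu_n=K$.
   Context: $(\Omega,\mathcal{A},\mathbb{P})$ is an atomless probability space and $L^0$ is the set of all real-valued random variables on it. $X\sim F$ means $X$ has distribution $F$, and $X\overset{d}{=}Y$ means equality in distribution. $(x)_+=\max\{x,0\}$ and $(x)_-=-\min\{x,0\}$. $(F_1,\dots,F_n)$ is jointly mixable with joint center $K$ if there exist random variables $Y_1,\dots,Y_n\in L^0$ with $Y_i\sim F_i$ for $i=1,\dots,n$ and $Y_1+\dots+Y_n=K$ almost surely. (The $X_i$ in the claim are only required to have the prescribed marginal distributions.) A law-determined norm $\|\cdot\|$ on $L^0$ is a map $L^0\to[0,\infty]$ (the value $\infty$ is allowed) such that (i) $\|aX\|=|a|\cdot\|X\|$ for $a\in\mathbb{R}$, $X\in L^0$ (with $0\cdot\infty=0$); (ii) $\|X+Y\|\le\|X\|+\|Y\|$ for $X,Y\in L^0$;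 (iii) $\|X\|=0$ implies $X=0$ almost surely; (iv) $\|X\|=\|Y\|$ if $X\overset{d}{=}Y$, $X,Y\in L^0$; (v) $\|X\|\le\|Y\|$ if $0\le X\le Y$ almost surely. *)

(* Defs.v *)
From HB Require Import structures.
From mathcomp Require Import all_boot all_order all_algebra.
From mathcomp Require Import all_classical all_reals all_analysis.
From mathcomp Require Import measurable_realfun.

Set Implicit Arguments.
Unset Strict Implicit.
Unset Printing Implicit Defensive.

Import Order.TTheory GRing.Theory Num.Theory.
Import numFieldNormedType.Exports.

Local Open Scope classical_set_scope.
Local Open Scope ring_scope.

Definition atomless d (T : measurableType d) (R : realType)
    (P : probability T R) : Prop :=
  forall A : set T, measurable A -> (0 < P A)%E ->
    exists B : set T, [/\ measurable B, B `<=` A, (0 < P B)%E & (P B < P A)%E].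

(* Distributions are compared on Borel sets only: the values of a library
   measure on non-measurable sets are unconstrained. *)
Definition has_law d (T : measurableType d) (R : realType)
    (P : probability T R) (X : {RV P >-> R})
    (F : probability R R) : Prop :=
  forall A : set R, measurable A -> distribution P X A = F A.
Arguments has_law {d T R} P X F.

Definition eq_law d (T : measurableType d) (R : realType)
    (P : probability T R) (X Y : {RV P >-> R}) : Prop :=
  forall A : set R, measurable A ->
    distribution P X A = distribution P Y A.
Arguments eq_law {d T R} P X Y.

Definition jointly_mixable d (T : measurableType d) (R : realType)
    (P : probability T R) (n : nat)
    (F : 'I_n -> probability R R) (K : R) : Prop :=
  exists Y : 'I_n -> {RV P >-> R},
    (forall i : 'I_n, has_law P (Y i) (F i)) /\
    {ae P, forall w, \sum_(i < n) Y i w = K}.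

(* The convention 0 * +oo = 0 in homogeneity is that of extended reals here. *)
Record law_determined_norm d (T : measurableType d) (R : realType)
    (P : probability T R) (N : {RV P >-> R} -> \bar R) : Prop :=
  LawDeterminedNorm {
    ldn_ge0 : forall X : {RV P >-> R}, (0 <= N X)%E ;
    ldn_homogeneous : forall (a : R) (X : {RV P >-> R}),
      N (a *: X) = (`|a|%:E * N X)%E ;
    ldn_triangle : forall X Y : {RV P >-> R}, (N (X + Y)%R <= N X + N Y)%E ;
    ldn_definite : forall X : {RV P >-> R},
      N X = 0%E -> {ae P, forall w, X w = 0} ;
    ldn_law : forall X Y : {RV P >-> R}, eq_law P X Y -> N X = N Y ;
    ldn_monotone : forall X Y : {RV P >-> R},
      {ae P, forall w, 0 <= X w <= Y w} -> (N X <= N Y)%E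
  }.
Arguments law_determined_norm {d T R} P N.

(* Main.v *)
Require Import Defs.
From mathcomp Require Import all_boot all_order all_algebra.
From mathcomp Require Import all_classical all_reals all_analysis.
From mathcomp Require Import measurable_realfun.

Set Implicit Arguments.
Unset Strict Implicit.

Import Order.TTheory GRing.Theory Num.Theory.
Import numFieldNormedType.Exports.
Local Open Scope classical_set_scope.
Local Open Scope ring_scope.

(** The norms of [(X j - mu j)_+] and [(X j - mu j)_-] depend only on the law of
    [X j], since these variables are fixed Borel functions of [X j]. So each [X j] may be replaced by the variable [Y j] of a coupling
    whose sum is almost surely [K] ([ldn_comp_eq_law]). The centred variables
    [Z j = Y j - mu j] then sum to zero almost surely, hence [Z i] is the sum of
    the [- Z j] over [j != i], and subadditivity of the positive part bounds
    [(Z i)_+] by the sum of the [(Z j)_-] ([pos_part_le_sum_neg_part]).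
    Monotonicity and the triangle inequality carry this pointwise bound over to
    the norm ([ldn_le_sum]). Changing the sign of every [Z j] exchanges positive
    and negative parts, which gives the other inequality. *)

Lemma pos_part_le_sum_neg_part (R : realDomainType) (I : finType) (z : I -> R)
    (i : I) :
  \sum_j z j = 0 ->
  Num.max (z i) 0 <= \sum_(j | j != i) Num.max (- z j) 0.
Proof.
rewrite (bigD1 i) //= => /eqP; rewrite addr_eq0 => /eqP ->.
rewrite ge_max -sumrN ler_sum /=; last by move=> j _; rewrite le_max lexx.
by apply: sumr_ge0 => j _; rewrite le_max lexx orbT.
Qed.

Lemma neg_part_le_sum_pos_part (R : realDomainType) (I : finType) (z : I -> R)
    (i : I) :
  \sum_j z j = 0 ->
  Num.max (- z i) 0 <= \sum_(j | j != i) Num.max (z j) 0.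
Proof.
move=> z0; under eq_bigr do rewrite -[z _]opprK.
by apply: (@pos_part_le_sum_neg_part _ _ (fun j => - z j)); rewrite sumrN z0 oppr0.
Qed.

Section law_determined_norm_theory.
Context d (T : measurableType d) (R : realType) (P : probability T R).
Context (N : {RV P >-> R} -> \bar R) (hN : law_determined_norm P N).

Lemma ldn0 : N 0 = 0%E.
Proof. by rewrite -(scale0r 0) (ldn_homogeneous hN) normr0 mul0e. Qed.

Lemma ldn_sum (I : Type) (s : seq I) (Q : pred I) (V : I -> {RV P >-> R}) :
  (N (\sum_(j <- s | Q j) V j)%R <= \sum_(j <- s | Q j) N (V j))%E.
Proof.
elim/big_rec2: _ => [|j y V' _ le_V'y]; first by rewrite ldn0.
exact: le_trans (ldn_triangle hN _ _) (leeD2l _ le_V'y).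
Qed.

Lemma ldn_le_sum (I : Type) (s : seq I) (Q : pred I) (V : I -> {RV P >-> R})
    (W : {RV P >-> R}) :
  {ae P, forall w, 0 <= W w <= \sum_(j <- s | Q j) V j w} ->
  (N W <= \sum_(j <- s | Q j) N (V j))%E.
Proof.
move=> WV; apply: le_trans (ldn_sum s Q V); apply: (ldn_monotone hN).
apply: filterS WV => w; congr (_ <= _ <= _).
by elim/big_rec2: _ => [|j y V' _ ->].
Qed.

(** [U] and [V] are separate variables, equal to [g \o X] and [g \o Y] as
    functions only: a random variable carries a proof of measurability, and
    that of [U] need not be the one obtained for the composite. *)
Lemma ldn_comp_eq_law (g : R -> R) (X Y U V : {RV P >-> R}) :
  measurable_fun [set: R] g -> eq_law P X Y ->
  U = g \o X :> (T -> R) -> V = g \o Y :> (T -> R) ->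
  N U = N V.
Proof.
move=> mg XY UX VY; apply: (ldn_law hN) => A mA.
have law_comp (X' U' : {RV P >-> R}) : U' = g \o X' :> (T -> R) ->
    distribution P U' A = distribution P X' (g @^-1` A).
  by move=> U'E; exact: (congr1 (fun f : T -> R => P (f @^-1` A)) U'E).
rewrite (law_comp X U UX) (law_comp Y V VY); apply: XY.
by rewrite -[_ @^-1` _]setTI; exact: mg.
Qed.

End law_determined_norm_theory.

Theorem theorem4 (d : measure_display) (T : measurableType d) (R : realType)
    (P : probability T R) (hP : atomless P)
    (n : nat) (hn : (1 <= n)%N)
    (F : 'I_n -> probability R R) (K : R)
    (hF : jointly_mixable P F K)
    (X : 'I_n -> {RV P >-> R}) (hX : forall i : 'I_n, has_law P (X i) (F i))
    (N : {RV P >-> R} -> \bar R) (hN : law_determined_norm P N)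
    (i : 'I_n) (mu : 'I_n -> R) (hmu : \sum_(j < n) mu j = K) :
  (N (X i \- cst (mu i))^\+%R <=
     \sum_(j < n | j != i) N (X j \- cst (mu j))^\-%R)%E /\
  (N (X i \- cst (mu i))^\-%R <=
     \sum_(j < n | j != i) N (X j \- cst (mu j))^\+%R)%E.
Proof.
have [Y [hY sumY]] := hF.
have XY j : eq_law P (X j) (Y j) by move=> A mA; rewrite hX // hY.
have mshift m : measurable_fun [set: R] (fun x : R => x - m).
  by apply: measurable_funB.
have Npos j : N (X j \- cst (mu j))^\+%R = N (Y j \- cst (mu j))^\+%R.
  exact: (ldn_comp_eq_law hN (measurable_funrpos (mshift (mu j))) (XY j)).
have Nneg j : N (X j \- cst (mu j))^\-%R = N (Y j \- cst (mu j))^\-%R.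
  exact: (ldn_comp_eq_law hN (measurable_funrneg (mshift (mu j))) (XY j)).
have sumZ w : \sum_(j < n) Y j w = K -> \sum_(j < n) (Y j w - mu j) = 0.
  by move=> YK; rewrite sumrB YK hmu subrr.
rewrite Npos Nneg; split.
- under eq_bigr do rewrite Nneg.
  apply: (ldn_le_sum hN); apply: filterS sumY => w /sumZ Z0.
  by rewrite funrpos_ge0; exact: (pos_part_le_sum_neg_part i Z0).
- under eq_bigr do rewrite Npos.
  apply: (ldn_le_sum hN); apply: filterS sumY => w /sumZ Z0.
  by rewrite funrneg_ge0; exact: (neg_part_le_sum_pos_part i Z0).
Qed.
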